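(* Let $b = 2^i 3^j$ with integers $i, j \ge 0$, $i + j > 0$, and $b < 10^{12}$. If $r$ is an integer with $2 \le r < b$ and $r \mid b$, then $D(b, r) = f(b) + 1$.
   Context: For a positive integer $n$, the complexity $f(n)$ is the least number of $1$'s needed to write $n$ as an expression using only the constant $1$, an arbitrary number of additions $+$, multiplications $*$, and parentheses (e.g. $f(6) \le 5$ since $6 = (1+1)(1+1+1)$). For integers $b \ge 1$ and $r \ge 0$, $D(b, r)$ denotes the smallest integer such that $f(r + bn) \le f(n) + D(b, r)$ holds for all positive integers $n$. *)

(* Defs.v *)
From mathcomp Require Import all_boot all_order all_algebra.
From Stdlib Require Import ClassicalEpsilon.
Set Implicit Arguments. Unset Strict Implicit. Unset Printing Implicit Defensive.

Inductive expr : Type :=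
| One : expr
| Add : expr -> expr -> expr
| Mul : expr -> expr -> expr.

Fixpoint eval (e : expr) : nat :=
  match e with
  | One => 1
  | Add a b => eval a + eval b
  | Mul a b => eval a * eval b
  end.

Fixpoint ones (e : expr) : nat :=
  match e with
  | One => 1
  | Add a b => ones a + ones b
  | Mul a b => ones a + ones b
  end.

Definition writable (n k : nat) : bool :=
  if excluded_middle_informative (exists e, eval e = n /\ ones e = k)
  then true else false.

Fixpoint unary (n : nat) : expr :=
  match n with
  | 0 | 1 => One
  | m.+1 => Add (unary m) One
  end.

Lemma unary_eval n : 0 < n -> eval (unary n) = n /\ ones (unary n) = n.
Proof.
elim: n => [//|[|m] IH _] //=.
by have [-> ->] := IH isT; rewrite !addn1.
Qed.

Lemma writable_ex n : 0 < n -> exists k, writable n k.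
Proof.
move=> n0; exists n; rewrite /writable.
case: excluded_middle_informative => // H; exfalso; apply: H.
by exists (unary n); apply: unary_eval.
Qed.

(* integer complexity f(n): least number of 1's needed to write n
   (for n = 0, which has no expression, the value 0 is a dummy) *)
Definition f (n : nat) : nat :=
  match ltnP 0 n with
  | LtnNotGeq n0 => ex_minn (writable_ex n0)
  | _ => 0
  end.

Definition is_D (b r : nat) (d : int) : Prop :=
  (forall n : nat, 0 < n -> ((f (r + b * n))%:Z <= (f n)%:Z + d)%R) /\
  (forall d' : int,
     (forall n : nat, 0 < n -> ((f (r + b * n))%:Z <= (f n)%:Z + d')%R) ->
     (d <= d')%R).

(* Main.v *)
(** Write [rho n = 3 ^ f n / n ^ 3]; it is at least [1], multiplicative along optimal
    products, and an optimal sum [x + v] with [x] large costs a factor [3 ^ f v], so that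
    [v] is tiny when [rho] is bounded.

    First, [f (2 ^ i * 3 ^ k) = 2 i + 3 k] for [i < 40] and every [k].  A minimal
    counterexample is an optimal sum [x + v], with [v <= 3] and [rho x] at most
    [(9/8) ^ 39 / 9 < 11].  Numbers with so small a [rho] are classified: they arise
    from 3-smooth numbers by multiplications and few small additions, and none of them equals
    [2 ^ i * 3 ^ k - v], by congruences when [k > 0] and by a finite check when [k = 0].
    As [f] is thus additive on the factorisation [b = r c], the upper bound follows from
    [r + b n = r (1 + c n)].

    For the lower bound take [n = 3 ^ m] with [m] large.  Numbers of bounded [rho] are sums
    of boundedly many powers of 3.  Hence in an optimal product equal to [A 3 ^ m + B] one
    factor [u] is bounded and divides both [A 3 ^ G] and [B], and an optimal sum has a
    summand [v <= B]; induction on [B] gives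
    [f (A 3 ^ m + B) >= 3 m + 1 + min_k (f (A 3 ^ k) - 3 k)]. *)

From Stdlib Require Import ClassicalEpsilon NArith.
Require Import Defs.
From mathcomp Require Import all_boot all_order all_algebra.
From mathcomp Require Import zify ring lra.
Set Implicit Arguments. Unset Strict Implicit. Unset Printing Implicit Defensive.
Import Order.TTheory GRing.Theory Num.Theory.

(** * Elementary bounds on integer complexity *)

Lemma writableP n k :
  reflect (exists e, eval e = n /\ ones e = k) (writable n k).
Proof.
by rewrite /writable; case: excluded_middle_informative => h; constructor.
Qed.

Lemma eval_gt0 e : 0 < eval e.
Proof. by elim: e => //= a ha b hb; rewrite ?addn_gt0 ?muln_gt0 ha ?hb. Qed.

Lemma ones_gt0 e : 0 < ones e.
Proof. by elim: e => //= a ha b hb; rewrite addn_gt0 ha. Qed.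

Lemma f_expr n : 0 < n -> exists e, eval e = n /\ ones e = f n.
Proof.
rewrite /f; case: ltnP => // n0 _.
by case: ex_minnP => k /writableP[e [? ?]] _; exists e.
Qed.

Lemma f_eval_le e : f (eval e) <= ones e.
Proof.
rewrite /f; case: ltnP => [n0|] //.
by case: ex_minnP => k _; apply; apply/writableP; exists e.
Qed.

Lemma f_gt0 n : 0 < n -> 0 < f n.
Proof. by move=> /f_expr[e [_ <-]]; exact: ones_gt0. Qed.

Lemma f_add m n : 0 < m -> 0 < n -> f (m + n) <= f m + f n.
Proof.
move=> /f_expr[a [<- <-]] /f_expr[b [<- <-]].
exact: (f_eval_le (Add a b)).
Qed.

Lemma f_mul m n : 0 < m -> 0 < n -> f (m * n) <= f m + f n.
Proof.
move=> /f_expr[a [<- <-]] /f_expr[b [<- <-]].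
exact: (f_eval_le (Mul a b)).
Qed.

Lemma f_le n : 0 < n -> f n <= n.
Proof.
by move=> /unary_eval[h1 h2]; have := f_eval_le (unary n); rewrite h1 h2.
Qed.

(** The last operation of a shortest expression. By commutativity the smaller summand is always
    called [v]. *)
Variant top_op (n : nat) : Prop :=
| TopAdd x v of 0 < v & v <= x & n = x + v & f n = f x + f v
| TopMul x y of 1 < x & 1 < y & n = x * y & f n = f x + f y.

(** Both arguments of the last operation are themselves written optimally, and a factor 1 would
    waste a 1. *)
Lemma f_top n : 1 < n -> top_op n.
Proof.
move=> n1; have [e [en fe]] := f_expr (ltnW n1).
case: e en fe => [|a b|a b] /= en fe; first by rewrite -en in n1.
- have [a0 b0] := (eval_gt0 a, eval_gt0 b).
  have fab : f n = f (eval a) + f (eval b).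
    apply/eqP; rewrite eqn_leq -{1}en f_add //=.
    by rewrite -fe leq_add ?f_eval_le.
  case: (leqP (eval b) (eval a)) => [h|/ltnW h].
    by apply: (TopAdd b0 h) => //; rewrite en.
  by apply: (TopAdd a0 h); rewrite 1?addnC ?en // fab addnC.
- have [a0 b0] := (eval_gt0 a, eval_gt0 b).
  have [oa ob] := (ones_gt0 a, ones_gt0 b).
  have [fa fb] := (f_eval_le a, f_eval_le b).
  have fab : f n = f (eval a) + f (eval b).
    apply/eqP; rewrite eqn_leq -{1}en f_mul //=.
    by rewrite -fe leq_add.
  have fga := f_gt0 a0; have fgb := f_gt0 b0.
  have a1 : 1 < eval a.
    case: (eval a =P 1) => [ea|]; last by lia.
    by move: fab; rewrite -en ea mul1n; rewrite ea in fga; lia.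
  have b1 : 1 < eval b.
    case: (eval b =P 1) => [ea|]; last by lia.
    by move: fab; rewrite -en ea muln1; rewrite ea in fgb; lia.
  by apply: (TopMul a1 b1).
Qed.

(** Products are immediate by induction, and a sum of two numbers at least 2 is at most their
    product; only adding 1 needs care. *)
Lemma cube_le_pow3_ones e : eval e ^ 3 <= 3 ^ ones e.
Proof.
elim: e => //= a ha b hb; last by rewrite expnMn expnD leq_mul.
have [a0 b0] := (eval_gt0 a, eval_gt0 b).
have [oa ob] := (ones_gt0 a, ones_gt0 b).
have one_case x y p q : x ^ 3 <= 3 ^ p -> 0 < x -> 0 < p -> 0 < q -> y = 1 ->
    (x + y) ^ 3 <= 3 ^ (p + q).
  move=> hx x0 p0 q0 ->.
  apply: (@leq_trans (3 ^ (p + 1))); last by rewrite leq_exp2l // leq_add2l.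
  (* The estimate [(x + 1) ^ 3 <= 3 * x ^ 3] holds from 3 on; for 2, [8 <= 3 ^ p] forces
     [p >= 2]. *)
  case: x hx x0 => [|[|[|x]]] // hx _.
  - by apply: (@leq_trans (3 ^ 2)) => //; rewrite leq_exp2l // addn1.
  - apply: (@leq_trans (3 ^ 3)) => //; rewrite leq_exp2l //.
    by case: p hx p0 => [|[|p]] // _ _; rewrite addn1.
  rewrite [p + 1]addn1 [3 ^ p.+1]expnS.
  apply: (@leq_trans (3 * x.+3 ^ 3)); last by rewrite leq_mul2l hx orbT.
  by rewrite addn1 !expnS !expn0; nia.
case: (eval b =P 1) => [b1|b1]; first exact: one_case.
case: (eval a =P 1) => [a1|a1].
  by rewrite addnC [ones a + _]addnC; exact: one_case.
rewrite expnD; apply: leq_trans (leq_mul ha hb).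
by rewrite -expnMn leq_exp2r //; nia.
Qed.

Lemma cube_le_pow3_f n : n ^ 3 <= 3 ^ f n.
Proof.
case: (posnP n) => [-> //|/f_expr[e [<- <-]]].
exact: cube_le_pow3_ones.
Qed.

Lemma f_pow3_le k n : 0 < n -> f (3 ^ k * n) <= 3 * k + f n.
Proof.
move=> n0; elim: k => [|k IH]; first by rewrite mul1n.
rewrite expnS -mulnA; apply: leq_trans (f_mul _ _) _ => //.
  by rewrite muln_gt0 expn_gt0.
by have := @f_le 3 isT; lia.
Qed.

Lemma f_pow2_le k n : 0 < n -> f (2 ^ k * n) <= 2 * k + f n.
Proof.
move=> n0; elim: k => [|k IH]; first by rewrite mul1n.
rewrite expnS -mulnA; apply: leq_trans (f_mul _ _) _ => //.
  by rewrite muln_gt0 expn_gt0.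
by have := @f_le 2 isT; lia.
Qed.

Lemma f_smooth_le a b : 0 < a + b -> f (2 ^ a * 3 ^ b) <= 2 * a + 3 * b.
Proof.
case: b => [|b] ab.
  case: a ab => [|a] // _; rewrite muln1 expnSr.
  apply: leq_trans (f_pow2_le _ _) _ => //.
  by have := @f_le 2 isT; lia.
apply: leq_trans (f_pow2_le _ _) _; first by rewrite expn_gt0.
rewrite expnSr; apply: leq_trans (leq_add (leqnn _) (f_pow3_le _ _)) _ => //.
by have := @f_le 3 isT; lia.
Qed.

(** * Defects *)

(* Sealed, so that conversion never unfolds the normalisation of fractions. *)
Definition Qf : realFieldType. Proof. exact: rat. Qed.

(* [rho n] is [3 ^ (f n - 3 log_3 n)], the exponential of the defect of [n]. *)
Definition rho (n : nat) : Qf := (3%:R ^+ f n / n%:R ^+ 3)%R.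

Lemma rho_ge1 n : 0 < n -> (1 <= rho n)%R.
Proof.
move=> n0; rewrite /rho ler_pdivlMr ?exprn_gt0 ?ltr0n // mul1r.
by rewrite -!natrX ler_nat cube_le_pow3_f.
Qed.

Lemma rho_mul x y : f (x * y) = f x + f y -> rho (x * y) = (rho x * rho y)%R.
Proof. by move=> h; rewrite /rho h natrM exprD exprMn invfM mulrACA. Qed.

Lemma rho_add x v : 0 < x -> f (x + v) = f x + f v ->
  (rho (x + v) * (x + v)%:R ^+ 3 = rho x * 3%:R ^+ f v * x%:R ^+ 3)%R.
Proof.
move=> x0 h; rewrite /rho h.
have hx : (x%:R ^+ 3 != 0 :> Qf)%R by rewrite expf_neq0 // pnatr_eq0 -lt0n.
have hn : ((x + v)%:R ^+ 3 != 0 :> Qf)%R.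
  by rewrite expf_neq0 // pnatr_eq0 -lt0n addn_gt0 x0.
by rewrite divfK // exprD [in RHS]mulrAC divfK.
Qed.

(** Carries a bound on [rho] from an optimal sum to its large summand; [p / q] bounds the ratio of
    the sum to [x]. *)
Lemma rho_summand x v p q (r : Qf) : 0 < x -> 0 < q ->
  f (x + v) = f x + f v -> q * (x + v) <= p * x -> (rho (x + v) <= r)%R ->
  (rho x * 3%:R ^+ f v <= r * (p%:R / q%:R) ^+ 3)%R.
Proof.
move=> x0 q0 h hpq hr.
have x30 : (0 < x%:R ^+ 3 :> Qf)%R by rewrite exprn_gt0 // ltr0n.
rewrite -(ler_pM2r x30) -rho_add // -[leRHS]mulrA -exprMn.
have n0 : 0 < x + v by rewrite addn_gt0 x0.
apply: ler_pM => //; first exact: le_trans ler01 (rho_ge1 n0).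
  by rewrite exprn_ge0 // ler0n.
rewrite lerXn2r ?nnegrE ?ler0n ?mulr_ge0 ?invr_ge0 ?ler0n //.
rewrite mulrAC ler_pdivlMr ?ltr0n // -!natrM ler_nat.
by rewrite mulnC.
Qed.

(** Since [rho x >= 1] and [v ^ 3 <= 3 ^ f v], the cube of [x * v / (x + v)] is at most
    [rho (x + v)]. For [v <= x] this bounds [v] by [2 * p / q]. *)
Lemma rho_sum_bound x v p q : 0 < x -> 0 < v -> 0 < q -> f (x + v) = f x + f v ->
  (rho (x + v) <= (p%:R / q%:R) ^+ 3)%R -> q * (x * v) <= p * (x + v).
Proof.
move=> x0 v0 q0 h hr.
have n0 : 0 < x + v by rewrite addn_gt0 x0.
have h1 : ((x * v)%:R ^+ 3 <= (p%:R / q%:R * (x + v)%:R) ^+ 3 :> Qf)%R.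
  rewrite [leRHS]exprMn.
  apply: (@le_trans _ _ (rho (x + v) * (x + v)%:R ^+ 3)%R); last first.
    by rewrite ler_wpM2r // exprn_ge0 // ler0n.
  rewrite rho_add // natrM exprMn -mulrA.
  apply: (@le_trans _ _ (3%:R ^+ f v * x%:R ^+ 3)%R).
    rewrite mulrC ler_wpM2r ?exprn_ge0 ?ler0n //.
    by rewrite -!natrX ler_nat cube_le_pow3_f.
  by rewrite ler_peMl ?mulr_ge0 ?exprn_ge0 ?ler0n ?rho_ge1.
move: h1; rewrite ler_pXn2r ?nnegrE ?ler0n ?mulr_ge0 ?invr_ge0 ?ler0n //.
by rewrite mulrAC ler_pdivlMr ?ltr0n // -!natrM ler_nat mulnC.
Qed.

Lemma pow98_lt a k (c : Qf) :
  ((9/8) ^+ a <= c -> c < (9/8) ^+ k -> (a < k)%N)%R.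
Proof.
have h98 : (1 < 9 / 8 :> Qf)%R by lra.
move=> h1 h2; rewrite ltnNge; apply/negP => ka.
by have := le_lt_trans h1 h2; rewrite ltNge ler_eXn2l ?ka.
Qed.

(** At cost 2 a factor 2 contributes [3 ^ 2 / 2 ^ 3 = 9 / 8]; at cost 3 a factor 3 contributes 1. *)
Lemma smooth_ratio a b :
  (3%:R ^+ (2 * a + 3 * b) / (2 ^ a * 3 ^ b)%:R ^+ 3 = (9 / 8) ^+ a :> Qf)%R.
Proof.
have h3 : ((3%:R ^+ 3) ^+ b != 0 :> Qf)%R by rewrite !expf_neq0 ?pnatr_eq0.
rewrite exprD natrM !natrX exprMn !exprM.
rewrite -!exprM [(a * 3)%N]mulnC [(b * 3)%N]mulnC !exprM.
rewrite invfM mulrACA divff // mulr1 -expr_div_n; congr (_ ^+ _)%R; lra.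
Qed.

Lemma rho_smooth n a b : n = 2 ^ a * 3 ^ b -> f n = 2 * a + 3 * b ->
  (rho n = (9 / 8) ^+ a)%R.
Proof. by move=> -> h; rewrite /rho h smooth_ratio. Qed.

(** * Small values of [f] and the numbers with small [rho] *)

Lemma f_1 : f 1 = 1. Proof. by have := @f_le 1 isT; have := @f_gt0 1 isT; lia. Qed.

Lemma f_ge n k : 3 ^ k < n ^ 3 -> k < f n.
Proof. by move=> h; rewrite -(@ltn_exp2l 3) // (leq_trans h) // cube_le_pow3_f. Qed.

Lemma f_2 : f 2 = 2.
Proof. by have := @f_le 2 isT; have := @f_ge 2 1 isT; lia. Qed.
Lemma f_3 : f 3 = 3.
Proof. by have := @f_le 3 isT; have := @f_ge 3 2 isT; lia. Qed.
Lemma f_4 : f 4 = 4.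
Proof. by have := @f_le 4 isT; have := @f_ge 4 3 isT; lia. Qed.
Lemma f_5 : f 5 = 5.
Proof. by have := @f_le 5 isT; have := @f_ge 5 4 isT; lia. Qed.

Lemma f_6 : f 6 = 5.
Proof.
have : f 6 <= f 2 + f 3 := @f_mul 2 3 isT isT.
by rewrite f_2 f_3; have := @f_ge 6 4 isT; lia.
Qed.

Lemma f_7 : f 7 = 6.
Proof.
have : f 7 <= f 6 + f 1 := @f_add 6 1 isT isT.
by rewrite f_6 f_1; have := @f_ge 7 5 isT; lia.
Qed.

Lemma rho_1 : rho 1 = 3%:R%R.
Proof. by rewrite /rho f_1; lra. Qed.

(** The bound is [rho 5]. In an optimal sum with [x >= 7] it forces [v = 1] and then [rho x < 1];
    smaller sums are listed, and products inherit the form. The bound on [a] holds because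
    [(9 / 8) ^ 6 > 243 / 125]. *)
Lemma low_rho_smooth n : 0 < n -> (rho n < 243 / 125)%R ->
  exists a b, [/\ n = 2 ^ a * 3 ^ b, f n = 2 * a + 3 * b & a <= 5].
Proof.
elim/ltn_ind: n => n IH n0 hn.
have [n1|n1] := leqP n 1.
  by have e : n = 1 by [lia]; move: hn; rewrite e rho_1; lra.
case: (f_top n1) => [x v v0 vx en fn|x y x1 y1 en fn].
- have x0 := leq_trans v0 vx; rewrite en in fn.
  (* [5 / 4] is slightly above the cube root of [243 / 125]. *)
  have hb : 4 * (x * v) <= 5 * (x + v).
    by apply: (rho_sum_bound x0 v0 (isT : 0 < 4) fn); rewrite -en; lra.
  have [x6|x7] := leqP x 6; last first.
    have v1 : v = 1 by nia.
    have h : 7 * (x + v) <= 8 * x by lia.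
    have := rho_summand x0 _ fn h; rewrite -en v1 f_1 => /(_ _ isT (ltW hn)).
    by have := rho_ge1 x0; lra.
  have : n \in [:: 2; 3; 4; 5; 6; 7].
    by rewrite en; have [->|] := eqVneq v 1; rewrite !inE; nia.
  rewrite !inE => /or4P[/eqP-> |/eqP-> |/eqP-> |/or3P[]/eqP e].
  + by exists 1, 0; rewrite f_2.
  + by exists 0, 1; rewrite f_3.
  + by exists 2, 0; rewrite f_4.
  + by move: hn; rewrite e /rho f_5; lra.
  + by exists 1, 1; rewrite e f_6.
  + by move: hn; rewrite e /rho f_7; lra.
- have [x0 y0] := (ltnW x1, ltnW y1).
  have e := hn; rewrite en rho_mul -?en // in e.
  have [hx hy] := (rho_ge1 x0, rho_ge1 y0).
  have [||a [b [ex fx _]]] := IH x _ x0; first by nia.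
    by nra.
  have [||c [d [ey fy _]]] := IH y _ y0; first by nia.
    by nra.
  have en' : n = 2 ^ (a + c) * 3 ^ (b + d).
    by rewrite en ex ey !expnD mulnACA.
  have fn' : f n = 2 * (a + c) + 3 * (b + d) by rewrite fn fx fy; lia.
  exists (a + c), (b + d); split=> //.
  apply: (@pow98_lt _ 6 (243/125)%R); last by lra.
  by rewrite -(rho_smooth en' fn') ltW.
Qed.

Definition pow3 (n : nat) : bool := n == 3 ^ logn 3 n.
Definition smooth (n : nat) : bool := n == 2 ^ logn 2 n * 3 ^ logn 3 n.

Lemma pow3P n : reflect (exists c, n = 3 ^ c) (pow3 n).
Proof.
apply: (iffP eqP) => [e|[c ->]]; first by exists (logn 3 n).
by rewrite pfactorK.
Qed.

Lemma smoothP n : reflect (exists a b, n = 2 ^ a * 3 ^ b) (smooth n).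
Proof.
apply: (iffP eqP) => [e|[a [b ->]]]; first by exists (logn 2 n), (logn 3 n).
by rewrite !lognM ?expn_gt0 // !lognX !logn_prime //= !muln0 !muln1 addn0.
Qed.

Lemma smooth_mul m n : smooth m -> smooth n -> smooth (m * n).
Proof.
move=> /smoothP[a [b ->]] /smoothP[c [d ->]]; apply/smoothP.
by exists (a + c), (b + d); rewrite !expnD mulnACA.
Qed.

Lemma pow3_mul m n : pow3 m -> pow3 n -> pow3 (m * n).
Proof.
move=> /pow3P[a ->] /pow3P[b ->]; apply/pow3P.
by exists (a + b); rewrite expnD.
Qed.

Lemma odd_smooth n : odd n -> smooth n -> pow3 n.
Proof.
move=> on /smoothP[[|a] [b e]]; last by move: on; rewrite e expnS -mulnA oddM.
by apply/pow3P; exists b; rewrite e mul1n.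
Qed.

Lemma rho_nonsmooth n : 0 < n -> ~~ smooth n -> (243 / 125 <= rho n)%R.
Proof.
move=> n0; apply: contraNT; rewrite -ltNge => /(low_rho_smooth n0)[a [b [e _ _]]].
by apply/smoothP; exists a, b.
Qed.

Lemma rho_odd n : odd n -> ~~ pow3 n -> (243 / 125 <= rho n)%R.
Proof.
move=> on hn; apply: rho_nonsmooth; first exact: odd_gt0.
by apply: contra hn; exact: odd_smooth.
Qed.

Lemma low_rho_pow98 n k : 0 < n -> (rho n < (9 / 8) ^+ k)%R -> k <= 5 ->
  exists a b, [/\ n = 2 ^ a * 3 ^ b, rho n = ((9 / 8) ^+ a)%R & a < k].
Proof.
move=> n0 hn k5.
have h5 : ((9 / 8) ^+ 5 < 243 / 125 :> Qf)%R by lra.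
have h98 : (1 < 9 / 8 :> Qf)%R by lra.
have hk : ((9 / 8) ^+ k <= (9 / 8) ^+ 5 :> Qf)%R by rewrite ler_eXn2l.
have [a [b [e fe _]]] := low_rho_smooth n0 (lt_trans (lt_le_trans hn hk) h5).
exists a, b; rewrite (rho_smooth e fe); split=> //.
by apply: (pow98_lt _ hn); rewrite (rho_smooth e fe).
Qed.

Lemma rho_nonpow3 n : 0 < n -> ~~ pow3 n -> (9 / 8 <= rho n)%R.
Proof.
move=> n0; apply: contraNT; rewrite -ltNge -[X in (_ < X)%R]expr1.
move=> /(low_rho_pow98 n0)[]// [|a] [b [e _ h]] //.
by apply/pow3P; exists b; rewrite e mul1n.
Qed.

Lemma f_pow3 a : 0 < a -> f (3 ^ a) = 3 * a.
Proof.
move=> a0; have := @f_smooth_le 0 a; rewrite add0n mul1n => /(_ a0) h.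
have : 3 * a <= f (3 ^ a) by rewrite -(@leq_exp2l 3) // mulnC expnM cube_le_pow3_f.
by lia.
Qed.

Lemma rho_pow3 a : 0 < a -> rho (3 ^ a) = 1%R.
Proof. by move=> a0; rewrite (@rho_smooth _ 0 a) ?mul1n ?f_pow3. Qed.

(** How an optimal expression can end after all factors that are powers of 3 are split off. *)
Variant core_op (y : nat) : Prop :=
| CoreAdd x v of 0 < v & v <= x & y = x + v & f (x + v) = f x + f v
| CoreMul s t of ~~ pow3 s & ~~ pow3 t & y = s * t & rho y = (rho s * rho t)%R.

(** A factor [3 ^ a] with [a > 0] has [rho] equal to 1, so removing it from an optimal product keeps
    [rho]. *)
Lemma strip_pow3 n : 0 < n -> ~~ pow3 n ->
  exists e y, [/\ n = 3 ^ e * y, rho n = rho y, ~~ pow3 y & core_op y].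
Proof.
elim/ltn_ind: n => n IH n0 hn.
have n1 : 1 < n.
  by case: n hn n0 {IH} => [|[|n]] //= /negP[]; apply/pow3P; exists 0.
case: (f_top n1) => [x v v0 vx en fn|x y x1 y1 en fn].
  exists 0, n; rewrite mul1n; split=> //.
  by apply: (CoreAdd v0 vx en); rewrite -en.
have rn : rho n = (rho x * rho y)%R by rewrite en rho_mul -?en.
have peel s t : 1 < s -> 1 < t -> n = s * t -> rho n = (rho s * rho t)%R ->
    pow3 s -> exists e y, [/\ n = 3 ^ e * y, rho n = rho y, ~~ pow3 y & core_op y].
  move=> s1 t1 est rst p3s.
  have p3t : ~~ pow3 t by apply: contra hn => ?; rewrite est pow3_mul.
  have [||e [z [ez rz hz oz]]] := IH t _ _ p3t; [by nia|by lia|].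
  have /pow3P[a ea] := p3s.
  exists (a + e), z; split=> //; first by rewrite expnD -mulnA -ez est ea.
  rewrite rst ea rho_pow3 ?mul1r //; by case: a ea s1 => [->|].
have [px|px] := boolP (pow3 x); first exact: (peel x y).
have [py|py] := boolP (pow3 y).
  by apply: (peel y x) => //; rewrite 1?mulnC // mulrC.
by exists 0, n; rewrite mul1n; split=> //; apply: (CoreMul px py).
Qed.

(** Two odd factors that are no powers of 3 give [rho] at least [(243 / 125) ^ 2 > 663 / 200], so
    the core is a sum. The constant lies just above the square root of [2197 / 200], so one factor
    of a product with [rho] at most [2197 / 200] obeys it. *)
Lemma odd_rho_le_3315 n : odd n -> ~~ pow3 n -> (rho n <= 663 / 200)%R ->
  exists c q, n = 3 ^ c * q /\ q \in [:: 5; 7; 13; 19; 55; 163].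
Proof.
move=> on hn rn; have [e [y [en ry hy oy]]] := strip_pow3 (odd_gt0 on) hn.
exists e, y; split=> //; rewrite ry in rn.
have {on}on : odd y by move: on; rewrite en oddM => /andP[].
case: oy => [x v v0 vx ey fy|s t hs ht ey]; last first.
  move=> rst; have /andP[os ot] : odd s && odd t by rewrite -oddM -ey.
  by have := rho_odd os hs; have := rho_odd ot ht; nra.
have x0 := leq_trans v0 vx; rewrite ey in rn.
have hb : 250 * (x * v) <= 373 * (x + v).
  by apply: (rho_sum_bound x0 v0 (isT : 0 < 250) fy); lra.
have [x5|x6] := leqP x 5.
  have : y \in [:: 3; 5; 7; 9] by rewrite !inE; nia.
  rewrite !inE => /or4P[]/eqP e'; rewrite e' ?orbT //.
  - by case/negP: hy; rewrite e'.
  - by case/negP: hy; rewrite e'.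
have v1 : v = 1 by nia.
rewrite {}v1 in vx ey fy rn {hb v0}.
have summand m : 0 < m -> m <= x ->
    (rho x * 3%:R <= 663 / 200 * (m.+1%:R / m%:R) ^+ 3)%R.
  move=> m0 mx; have h : m * (x + 1) <= m.+1 * x by lia.
  by have := rho_summand x0 m0 fy h rn; rewrite f_1 expr1.
have [|//|a [b [ex rx a5]]] := @low_rho_pow98 x 5 x0.
  by have := summand 6 isT x6; lra.
have a0 : 0 < a.
  case: a ex {rx a5} => // ex; move: on; rewrite ey ex mul1n oddD oddX.
  by rewrite orbT.
rewrite rx in summand.
(* From 24 on [rho x] is below [(9 / 8) ^ 2], and from 486 on it would be below [9 / 8]; this leaves
   54 and 162. *)
have [x24|x24] := leqP 24 x.
  have : a < 2 by apply: (pow98_lt (lexx _)); have := summand 24 isT x24; lra.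
  move=> a2; have {a0 a2 a5}a1 : a = 1 by lia.
  rewrite {}a1 in ex rx summand.
  have b4 : b < 5.
    rewrite ltnNge; apply/negP => b5.
    have : 486 <= x by rewrite ex (@leq_mul 2 (3 ^ 5)) // leq_exp2l.
    by move/(summand 486 isT); lra.
  by move: x24; rewrite ey ex; case: b b4 {ex} => [|[|[|[|[|]]]]].
have b3 : b < 3.
  rewrite ltnNge; apply/negP => b3.
  have : 2 ^ 1 * 3 ^ 3 <= x by rewrite ex leq_mul // leq_exp2l.
  by lia.
have a4 : a < 4.
  rewrite ltnNge; apply/negP => h.
  have x9 : 8 < x.
    by apply: (@leq_trans (2 ^ 4 * 3 ^ 0)) => //; rewrite ex leq_mul // leq_exp2l.
  have : a < 4 by apply: (pow98_lt (lexx _)); have := summand 9 isT x9; lra.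
  by rewrite ltnNge h.
move: ex; case: a a0 a4 {rx a5 summand} => [|[|[|[|]]]] //= _ _;
  case: b b3 => [|[|[|]]] //= _ ex; rewrite ex // in x6 x24 ey;
  by rewrite ey // in hy *.
Qed.

(** In a product each factor has [rho] at most [(283 / 50) / (243 / 125) < 663 / 200], so both come
    from the list ending in 163. A large sum has [v = 1] and a 3-smooth [x]. *)
Lemma odd_rho_le_566 n : odd n -> ~~ pow3 n -> (rho n <= 283 / 50)%R ->
  exists c y, n = 3 ^ c * y /\
    (y <= 163 * 163 \/ exists a b, a <= 5 /\ y = 2 ^ a * 3 ^ b + 1).
Proof.
move=> on hn rn; have [e [y [en ry hy oy]]] := strip_pow3 (odd_gt0 on) hn.
rewrite ry in rn.
have {on}on : odd y by move: on; rewrite en oddM => /andP[].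
case: oy => [x v v0 vx ey fy|s t hs ht ey rst]; last first.
  have /andP[os ot] : odd s && odd t by rewrite -oddM -ey.
  have [rs rt] := (rho_odd os hs, rho_odd ot ht); rewrite rst in rn.
  have [|c [q [es hq]]] := odd_rho_le_3315 os hs; first by nra.
  have [|d [q' [et hq']]] := odd_rho_le_3315 ot ht; first by nra.
  exists (e + (c + d)), (q * q'); split.
    by rewrite en ey es et !expnD -!mulnA [q * _]mulnCA.
  have /allP small : all (leq^~ 163) [:: 5; 7; 13; 19; 55; 163] by [].
  by left; apply: leq_mul; exact: small.
exists e, y; split=> //.
have [ysmall|ybig] := leqP y (163 * 163); [by left|right].
have x0 := leq_trans v0 vx; rewrite ey in rn.
have hb : 5 * (x * v) <= 9 * (x + v).
  by apply: (rho_sum_bound x0 v0 (isT : 0 < 5) fy); lra.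
have v1 : v = 1 by nia.
rewrite v1 in fy rn.
have h : 1000 * (x + 1) <= 1001 * x by lia.
have := rho_summand x0 (isT : 0 < 1000) fy h rn; rewrite f_1 expr1 => rx.
have [|a [b [ex _ a5]]] := low_rho_smooth x0; first by lra.
by exists a, b; rewrite ey ex v1.
Qed.

(* The constant is below [(243 / 125) ^ 2], so that at most one factor is not 3-smooth. *)
Lemma strip_smooth n : 0 < n -> ~~ smooth n -> (rho n <= 377 / 100)%R ->
  exists a b y x v, [/\ n = 2 ^ a * 3 ^ b * y, rho n = ((9 / 8) ^+ a * rho y)%R,
    ~~ smooth y & [/\ 0 < v, v <= x, y = x + v & f (x + v) = f x + f v]].
Proof.
elim/ltn_ind: n => n IH n0 hn rn.
have n1 : 1 < n.
  by case: n hn n0 {IH rn} => [|[|n]] //= /negP[]; apply/smoothP; exists 0, 0.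
case: (f_top n1) => [x v v0 vx en fn|x y x1 y1 en fn].
  exists 0, 0, n, x, v; rewrite !mul1n expr0 mul1r -en; split=> //.
have rxy : rho n = (rho x * rho y)%R by rewrite en rho_mul -?en.
have peel s t : 1 < s -> 1 < t -> n = s * t -> rho n = (rho s * rho t)%R ->
    (rho s < 243 / 125)%R -> exists a b y x v, [/\ n = 2 ^ a * 3 ^ b * y,
    rho n = ((9 / 8) ^+ a * rho y)%R, ~~ smooth y &
    [/\ 0 < v, v <= x, y = x + v & f (x + v) = f x + f v]].
  move=> s1 t1 est rst rs.
  have [a [b [es fs _]]] := low_rho_smooth (ltnW s1) rs.
  have ht : ~~ smooth t.
    apply: contra hn => ht; rewrite est smooth_mul //.
    by apply/smoothP; exists a, b.
  have [r1 r2] := (rho_ge1 (ltnW s1), rho_ge1 (ltnW t1)).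
  have [|||a' [b' [z [x' [v' [et rt hz oz]]]]]] := IH t _ _ ht; [by nia|by lia|by nra|].
  exists (a + a'), (b + b'), z, x', v'; split=> //.
    by rewrite est es et !expnD; ring.
  by rewrite rst rt (rho_smooth es fs) exprD mulrA.
have [rx|rx] := ltP (rho x) (243 / 125)%R; first exact: (peel x y).
have [ry|ry] := ltP (rho y) (243 / 125)%R.
  by apply: (peel y x) => //; rewrite 1?mulnC // mulrC.
by exfalso; nra.
Qed.

(** Stripping 3-smooth factors leaves an optimal sum [y]. Once [y > 88] it is [x + 1], and
    [(9 / 8) ^ a * rho x < (9 / 8) ^ 2] bounds [a + d]. *)
Lemma rho_le_367 n : 0 < n -> ~~ smooth n -> (rho n <= 367 / 100)%R ->
  exists a b y, [/\ n = 2 ^ a * 3 ^ b * y, a <= 5 &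
    y <= 88 \/ exists d c, y = 2 ^ d * 3 ^ c + 1 /\ a + d <= 1].
Proof.
move=> n0 hn rn.
have [|a [b [y [x [v [en ry hy [v0 vx ey fy]]]]]]] := strip_smooth n0 hn.
  by lra.
have x0 := leq_trans v0 vx.
have y0 : 0 < y by rewrite ey addn_gt0 x0.
have a1 : (1 <= (9 / 8) ^+ a :> Qf)%R.
  by rewrite -(expr0 (9 / 8)%R) ler_eXn2l //; lra.
have r1 := rho_nonsmooth y0 hy.
have ryle : ((9 / 8) ^+ a * rho y <= 367 / 100)%R by rewrite -ry.
exists a, b, y; split=> //.
  apply: (@pow98_lt _ 6 2%:R%R); last by lra.
  by nra.
have [ysmall|ybig] := leqP y 88; [by left|right].
have hb : 20 * (x * v) <= 31 * (x + v).
  by apply: (rho_sum_bound x0 v0 (isT : 0 < 20) fy); rewrite -ey; nra.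
have v1 : v = 1 by nia.
rewrite v1 in fy ey.
(* 88 is the least [x] for which [367 / 300 * ((x + 1) / x) ^ 3] is below [(9 / 8) ^ 2]. *)
have h : 88 * (x + 1) <= 89 * x by lia.
have := rho_summand x0 (isT : 0 < 88) fy h (lexx _); rewrite f_1 expr1 -ey => rx.
have rx' : ((9 / 8) ^+ a * rho x < (9 / 8) ^+ 2)%R.
  have : ((9 / 8) ^+ a * (rho x * 3%:R) <= (9 / 8) ^+ a * (rho y * (89%:R / 88%:R) ^+ 3))%R.
    by rewrite ler_wpM2l //; lra.
  rewrite mulrA [leRHS]mulrA => h2.
  have : ((9 / 8) ^+ a * rho y * (89%:R / 88%:R) ^+ 3 <= 367 / 100 * (89%:R / 88%:R) ^+ 3)%R.
    by rewrite ler_wpM2r //; lra.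
  by lra.
have rx1 := rho_ge1 x0.
have [|d [c [ex ed d2]]] := @low_rho_pow98 x 2 x0 _ isT; first by nra.
exists d, c; rewrite ey ex; split=> //.
by apply: (pow98_lt _ rx'); rewrite exprD ed.
Qed.

(** * Powers of two up to [2 ^ 39] *)

(* Decides whether [2 ^ i = D * (D' * (2 ^ a * 3 ^ b + l) + k) + 1] has a solution
   with [2 ^ a * 3 ^ b] dividing [2 ^ A * 3 ^ B]. *)
Definition solvable (i D k D' l A B : N) : bool :=
  let u := (2 ^ i - 1)%num in
  if (u mod D =? 0)%num then
    let z := (u / D - k)%num in
    if (z mod D' =? 0)%num then
      ((2 ^ A * 3 ^ B) mod (z / D' - l) =? 0)%num
    else false
  else false.

Lemma of_nat_expn m n : N.of_nat (m ^ n) = (N.of_nat m ^ N.of_nat n)%num.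
Proof.
elim: n => [|n IH] //.
by rewrite expnS Nat2N.inj_mul IH Nat2N.inj_succ N.pow_succ_r'.
Qed.

Lemma solvable_true i D k D' l A B a b : 0 < D -> 0 < D' -> a <= A -> b <= B ->
  2 ^ i = D * (D' * (2 ^ a * 3 ^ b + l) + k) + 1 ->
  solvable (N.of_nat i) (N.of_nat D) (N.of_nat k) (N.of_nat D') (N.of_nat l)
    (N.of_nat A) (N.of_nat B).
Proof.
move=> D0 D'0 aA bB e; rewrite /solvable.
have nz m : 0 < m -> N.of_nat m <> 0%num by case: m.
have -> : (2 ^ N.of_nat i - 1 = N.of_nat (D' * (2 ^ a * 3 ^ b + l) + k) * N.of_nat D)%num.
  have := congr1 N.of_nat e; rewrite of_nat_expn Nat2N.inj_add => ->.
  by rewrite N.add_sub Nat2N.inj_mul N.mul_comm.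
rewrite N.Div0.mod_mul /= N.div_mul; last exact: nz.
have -> : (N.of_nat (D' * (2 ^ a * 3 ^ b + l) + k) - N.of_nat k =
    N.of_nat (2 ^ a * 3 ^ b + l) * N.of_nat D')%num.
  by rewrite Nat2N.inj_add N.add_sub Nat2N.inj_mul N.mul_comm.
rewrite N.Div0.mod_mul /= N.div_mul; last exact: nz.
rewrite Nat2N.inj_add N.add_sub.
have -> : (2 ^ N.of_nat A * 3 ^ N.of_nat B = N.of_nat (2 ^ (A - a) * 3 ^ (B - b)) *
    N.of_nat (2 ^ a * 3 ^ b))%num.
  have e' : 2 ^ A * 3 ^ B = 2 ^ (A - a) * 3 ^ (B - b) * (2 ^ a * 3 ^ b).
    by rewrite mulnACA -!expnD !subnK.
  by have := congr1 N.of_nat e'; rewrite !Nat2N.inj_mul !of_nat_expn.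
by rewrite N.Div0.mod_mul.
Qed.

Lemma smooth_exponents i a b : 2 ^ a * 3 ^ b <= 2 ^ i -> (a <= i) * (b <= i).
Proof.
move=> h; have [a0 b0] : 0 < 2 ^ a /\ 0 < 3 ^ b by rewrite !expn_gt0.
split; rewrite -(@leq_exp2l 2) //.
  by apply: leq_trans h; rewrite leq_pmulr.
apply: leq_trans h; apply: (@leq_trans (3 ^ b)); last by rewrite leq_pmull.
by case: (b) => // b'; rewrite leq_exp2r.
Qed.

(** Covers [2 ^ i = 3 ^ e * (x + 1) + 1] with [x] a 3-smooth multiple of a small [y]. Both exponents
    in the 3-smooth factor are at most 39, so divisibility of [2 ^ 39 * 3 ^ 39] tests for all of
    them at once. *)
Lemma no_small_cofactor i e y a b : 19 <= i < 40 -> e < 4 -> 0 < y <= 88 ->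
  2 ^ i <> 3 ^ e * (2 ^ a * 3 ^ b * y + 1) + 1.
Proof.
move=> hi he hy eq.
have : all (fun i => all (fun e => all (fun y => ~~ solvable (N.of_nat i)
    (3 ^ N.of_nat e) 1 (N.of_nat y) 0 39 39) (iota 1 88)) (iota 0 4)) (iota 19 21).
  by vm_compute.
move=> /allP/(_ i); rewrite mem_iota => /(_ hi).
move=> /allP/(_ e); rewrite mem_iota => /(_ he).
move=> /allP/(_ y); rewrite mem_iota => /(_ hy)/negP[].
have [h1 h2] : (a <= i) * (b <= i).
  apply: smooth_exponents; rewrite eq.
  have p0 : 0 < 3 ^ e by rewrite expn_gt0.
  case/andP: hy => y0 _; rewrite (leq_trans (leq_pmulr _ y0)) //.
  by rewrite !addn1 ltnW // ltnS (leq_trans (leqnSn _)) // leq_pmull.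
rewrite -(of_nat_expn 3); apply: (@solvable_true i (3 ^ e) 1 y 0 39 39 a b) => //.
- by rewrite expn_gt0.
- by case/andP: hy.
- by lia.
- by lia.
by rewrite eq addn0 [y * _]mulnC.
Qed.

Lemma no_form_cofactor i e a b d c : 19 <= i < 40 -> e < 4 -> a + d <= 1 ->
  2 ^ i <> 3 ^ e * (2 ^ a * 3 ^ b * (2 ^ d * 3 ^ c + 1) + 1) + 1.
Proof.
move=> hi he had eq.
have : all (fun i => all (fun e => all (fun a => all (fun b => ~~ solvable (N.of_nat i)
    (3 ^ N.of_nat e) 1 (2 ^ N.of_nat a * 3 ^ N.of_nat b) 1 1 39)
    (iota 0 40)) (iota 0 2)) (iota 0 4)) (iota 19 21).
  by vm_compute.
move=> /allP/(_ i); rewrite mem_iota => /(_ hi).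
move=> /allP/(_ e); rewrite mem_iota => /(_ he).
move=> /allP/(_ a); rewrite mem_iota => /(_ _)/allP; move/(_ (leq_trans (leq_addr d a) had)).
have [p0 q0 r0] : [/\ 0 < 3 ^ e, 0 < 2 ^ a * 3 ^ b & 0 < 2 ^ d * 3 ^ c].
  by rewrite !muln_gt0 !expn_gt0.
have [_ hb] : (a <= i) * (b <= i).
  apply: smooth_exponents; rewrite eq.
  move: p0 q0 r0; set p := 3 ^ e; set q := 2 ^ a * 3 ^ b; set r := 2 ^ d * 3 ^ c.
  by clearbody p q r; nia.
have [_ hc] : (d <= i) * (c <= i).
  apply: smooth_exponents; rewrite eq.
  move: p0 q0 r0; set p := 3 ^ e; set q := 2 ^ a * 3 ^ b; set r := 2 ^ d * 3 ^ c.
  by clearbody p q r; nia.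
move=> /(_ b); rewrite mem_iota => /(_ _)/negP; apply; first by lia.
rewrite -!(of_nat_expn 3) -(of_nat_expn 2) -Nat2N.inj_mul.
apply: (@solvable_true i (3 ^ e) 1 (2 ^ a * 3 ^ b) 1 1 39 d c) => //; by lia.
Qed.

Lemma no_add2_cofactor i e d c : 19 <= i < 40 -> e < 4 -> d <= 1 ->
  2 ^ i <> 3 ^ e * (2 ^ d * 3 ^ c + 2) + 1.
Proof.
move=> hi he hd eq.
have : all (fun i => all (fun e => ~~ solvable (N.of_nat i)
    (3 ^ N.of_nat e) 2 1 0 1 39) (iota 0 4)) (iota 19 21).
  by vm_compute.
move=> /allP/(_ i); rewrite mem_iota => /(_ hi).
move=> /allP/(_ e); rewrite mem_iota => /(_ he)/negP[].
have p0 : 0 < 3 ^ e by rewrite expn_gt0.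
have [_ hc] : (d <= i) * (c <= i).
  apply: smooth_exponents; rewrite eq.
  by move: p0; set p := 3 ^ e; set r := 2 ^ d * 3 ^ c; clearbody p r; nia.
rewrite -(of_nat_expn 3); apply: (@solvable_true i (3 ^ e) 2 1 0 1 39 d c) => //.
  by lia.
by rewrite eq addn0 mul1n.
Qed.

Lemma no_mul_cofactor i e q a b : 19 <= i < 40 -> e < 4 ->
  q \in [:: 5; 7; 13; 19; 55; 163] -> a <= 5 ->
  2 ^ i <> 3 ^ e * q * (2 ^ a * 3 ^ b + 1) + 1.
Proof.
move=> hi he hq ha eq.
have : all (fun i => all (fun e => all (fun q => ~~ solvable (N.of_nat i)
    (3 ^ N.of_nat e * N.of_nat q) 1 1 0 5 39) [:: 5; 7; 13; 19; 55; 163])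
    (iota 0 4)) (iota 19 21).
  by vm_compute.
move=> /allP/(_ i); rewrite mem_iota => /(_ hi).
move=> /allP/(_ e); rewrite mem_iota => /(_ he).
move=> /allP/(_ q hq)/negP[].
have /allP q0 : all (leq 1) [:: 5; 7; 13; 19; 55; 163] by [].
have p0 : 0 < 3 ^ e * q by rewrite muln_gt0 expn_gt0; exact: q0.
have [_ hc] : (a <= i) * (b <= i).
  apply: smooth_exponents; rewrite eq.
  by move: p0; set p := 3 ^ e * q; set r := 2 ^ a * 3 ^ b; clearbody p r; nia.
rewrite -(of_nat_expn 3) -Nat2N.inj_mul.
apply: (@solvable_true i (3 ^ e * q) 1 1 0 5 39 a b) => //.
  by lia.
by rewrite eq addn0 mul1n.
Qed.

(** The order of 2 modulo 81 is 54, which exceeds every [i] in the range. *)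
Lemma pow3_dvd_pow2_pred i e y : 19 <= i < 40 -> 2 ^ i = 3 ^ e * y + 1 -> e < 4.
Proof.
move=> hi eq; rewrite ltnNge; apply/negP => e4.
have : all (fun i => ~~ ((2 ^ N.of_nat i) mod 81 =? 1)%num) (iota 19 21).
  by vm_compute.
move=> /allP/(_ i); rewrite mem_iota => /(_ hi)/negP[].
have e' : 2 ^ i = 1 + 3 ^ (e - 4) * y * 81.
  by rewrite eq addnC mulnAC -(expnD 3 (e - 4) 4) subnK.
have := congr1 N.of_nat e'; rewrite of_nat_expn Nat2N.inj_add Nat2N.inj_mul => ->.
by rewrite N.Div0.mod_add.
Qed.

(** * Congruences and the defect of [2 ^ i * 3 ^ k] minus 1 or 2 *)

Lemma pow3_mod8 b : (3 ^ b %% 8 == 1) || (3 ^ b %% 8 == 3).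
Proof.
elim: b => [|b IH] //; rewrite expnS; set p := 3 ^ b in IH *.
by clearbody p; lia.
Qed.

Lemma dvdn16_smooth i k : 19 <= i -> 16 %| 2 ^ i * 3 ^ k.
Proof. by move=> hi; rewrite dvdn_mulr // (@dvdn_exp2l 2 4) // (leq_trans _ hi). Qed.

(** For [a = 1] the sum is 4 or 8 modulo 16; otherwise it is odd or 2 modulo 4. *)
Lemma smooth_add2 a b : ~~ (16 %| 2 ^ a * 3 ^ b + 2).
Proof.
have := pow3_mod8 b; set p := 3 ^ b.
case: a => [|[|a]]; first by clearbody p; lia.
  by clearbody p; lia.
by rewrite !expnS -!mulnA; set q := 2 ^ a * p; clearbody q => _; lia.
Qed.

Lemma pow2_gt i : 19 <= i -> 300 * 300 < 2 ^ i.
Proof.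
move=> hi; apply: leq_trans (@ltn_mul 300 300 (2 ^ 9) (2 ^ 9) isT isT) _.
by rewrite -expnD leq_exp2l // (leq_trans _ hi).
Qed.

(** Numbers with [rho] at most [367 / 100] have been classified, and the computed tables exclude
    each form. *)
Lemma pow2_defect i e x : 19 <= i < 40 -> e < 4 -> 0 < x ->
  2 ^ i = 3 ^ e * (x + 1) + 1 -> (367 / 100 < rho x)%R.
Proof.
move=> hi he x0 eq; rewrite ltNge; apply/negP => rx.
have [/smoothP[a [b ex]]|hx] := boolP (smooth x).
  apply: (@no_small_cofactor i e 1 a b) => //.
  by rewrite muln1 -ex.
have [a [b [y [ex a5 [y88|[d [c [ey ad]]]]]]]] := rho_le_367 x0 hx rx.
  apply: (@no_small_cofactor i e y a b) => //; last by rewrite -ex.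
  by rewrite y88 andbT; move: x0; rewrite ex muln_gt0 => /andP[].
by apply: (@no_form_cofactor i e a b d c) => //; rewrite -ey -ex.
Qed.

(** For [k = 0] read [x + 2] as [(x + 1) + 1]. For [k > 0], [x] is prime to 3, so its stripped
    factor is a power of 2, and divisibility by 16 excludes what size does not. *)
Lemma smooth_sub2_defect i k x : 19 <= i < 40 -> 2 ^ i * 3 ^ k = x + 2 ->
  (367 / 100 < rho x)%R.
Proof.
move=> hi eq; have /andP[i19 i40] := hi.
have big : 300 * 300 < x + 2.
  by rewrite -eq (leq_trans (pow2_gt i19)) // leq_pmulr ?expn_gt0.
have x0 : 0 < x by lia.
have d16 := dvdn16_smooth k i19; rewrite eq in d16.
case: k eq => [|k] eq.
  by apply: (@pow2_defect i 0) => //; move: eq; rewrite !muln1 mul1n; lia.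
rewrite ltNge; apply/negP => rx.
have d3 : 3 %| x + 2 by rewrite -eq dvdn_mull // expnS dvdn_mulr.
have [/smoothP[a [b ex]]|hx] := boolP (smooth x).
  by have := smooth_add2 a b; rewrite -ex d16.
have [a [b [y [ex a5 hy]]]] := rho_le_367 x0 hx rx.
case: b ex => [|b] ex; last first.
  have : 3 %| x by rewrite ex expnS dvdn_mulr // dvdn_mull // dvdn_mulr.
  by lia.
rewrite muln1 in ex.
case: hy => [y88|[d [c [ey ad]]]].
  have : x <= 2 ^ 5 * 88 by rewrite ex leq_mul // leq_exp2l.
  by lia.
have := pow3_mod8 c; move: ex ad d16; rewrite ey; set p := 3 ^ c; clearbody p => ex.
rewrite ex; case: a d {a5 ey ex} => [|[|a]] [|[|d]] //= _; rewrite ?expn0 ?expn1; lia.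
Qed.

Lemma smooth_add3 i k d c : 19 <= i -> d < 2 -> 2 ^ i * 3 ^ k <> 2 ^ d * 3 ^ c + 3.
Proof.
move=> hi hd eq; have := dvdn16_smooth k hi; rewrite eq.
have := pow3_mod8 c; set p := 3 ^ c; clearbody p.
by case: d hd {eq} => [|[|]] // _; rewrite ?expn0 ?expn1; lia.
Qed.

(** Size excludes small [b]; otherwise reduction modulo 3 forces [q = 5], modulo 16 [a = 1] and
    modulo 9 [k = 1]. Cancelling 3 leaves an equation from the computed table. *)
Lemma smooth_pred_mul i k q a b : 19 <= i < 40 -> 0 < k ->
  q \in [:: 5; 7; 13; 19; 55; 163] -> a <= 5 ->
  2 ^ i * 3 ^ k <> q * (2 ^ a * 3 ^ b + 1) + 1.
Proof.
move=> hi k0 hq a5 eq; have /andP[i19 _] := hi.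
have d16 := dvdn16_smooth k i19; rewrite eq in d16.
have d3 : 3 %| q * (2 ^ a * 3 ^ b + 1) + 1.
  by rewrite -eq dvdn_mull // dvdn_exp.
have a32 : 2 ^ a <= 32 by rewrite (@leq_exp2l 2 a 5).
have big : 300 * 300 < q * (2 ^ a * 3 ^ b + 1) + 1.
  by rewrite -eq (leq_trans (pow2_gt i19)) // leq_pmulr ?expn_gt0.
case: b eq d16 d3 big => [|b] eq d16 d3 big.
  have /allP small : all (leq^~ 163) [:: 5; 7; 13; 19; 55; 163] by [].
  have := small q hq; move: big a32; rewrite muln1; set p := 2 ^ a; clearbody p => *.
  by nia.
have q5 : q = 5.
  have : 3 %| q + 1.
    move: d3; rewrite mulnDr muln1 expnS [2 ^ a * _]mulnCA mulnCA -addnA.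
    by rewrite dvdn_addr // dvdn_mulr.
  by move: hq; rewrite !inE => /or4P[/eqP->|/eqP->|/eqP->|/or3P[]/eqP->].
rewrite {}q5 {hq} in eq d16 d3 big.
have a1 : a = 1.
  move: d16; case: a {eq d3 big a5 a32} => [|[|a]] //.
    have := pow3_mod8 b.+1; set p := 3 ^ b.+1; clearbody p.
    by rewrite mul1n; lia.
  by rewrite !expnS -!mulnA; set p := 2 ^ a * _; clearbody p; lia.
rewrite {}a1 {a5 a32} in eq d16 d3 big.
case: b eq {d16 d3} big => [|b] eq big; first by move: big; rewrite !expn1; lia.
case: k k0 eq => [|[|k]] // _ eq; last first.
  have : 9 %| 2 ^ i * 3 ^ k.+2.
    by rewrite dvdn_mull // (@dvdn_exp2l 3 2).
  rewrite eq !expnS; set p := 3 ^ b; clearbody p.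
  by lia.
apply: (@no_small_cofactor i 0 5 1 b.+1) => //.
move: eq; rewrite !expnS !expn0; set p := 3 ^ b; set r := 2 ^ i; clearbody p r.
by lia.
Qed.

Lemma smooth_pred_pow3 i k e y : 19 <= i < 40 -> 2 ^ i * 3 ^ k = 3 ^ e * y + 1 ->
  e < 4 /\ (0 < k -> e = 0).
Proof.
move=> hi eq; have e0 : 0 < k -> e = 0.
  move=> k0; apply/eqP; rewrite -leqn0 leqNgt; apply/negP => e0.
  have : 3 %| 3 ^ e * y + 1 by rewrite -eq dvdn_mull // dvdn_exp.
  by rewrite dvdn_addr // dvdn_mulr // dvdn_exp.
split=> //; case: (posnP k) => [k0|/e0-> //].
by apply: (pow3_dvd_pow2_pred hi (y := y)); rewrite -eq k0 muln1.
Qed.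

(** [u] is odd. If its core is a sum, it ends in 1 or 2 and the large summand contradicts the
    earlier results; if it is a product, both factors have [rho] at least [243 / 125], whose square
    exceeds [377 / 100]. *)
Lemma smooth_pred_defect i k u : 19 <= i < 40 -> 2 ^ i * 3 ^ k = u + 1 ->
  (rho u <= 2197 / 200)%R -> i < 30 /\ (377 / 100 <= rho u)%R.
Proof.
move=> hi eq ru; have /andP[i19 i40] := hi.
have big : 300 * 300 < u + 1.
  by rewrite -eq (leq_trans (pow2_gt i19)) // leq_pmulr ?expn_gt0.
have u0 : 0 < u by lia.
have hu : ~~ pow3 u.
  apply/pow3P => -[c ec]; have := dvdn16_smooth k i19; rewrite eq ec.
  by have := pow3_mod8 c; set p := 3 ^ c; clearbody p; lia.
have ou : odd u.
  by have := dvdn16_smooth k i19; rewrite eq; lia.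
have [e [y [eu ry hy oy]]] := strip_pow3 u0 hu.
have eq' := eq; rewrite eu in eq'.
have [e4 ek] := smooth_pred_pow3 hi eq'.
have e27 : 3 ^ e <= 27 by rewrite (@leq_exp2l 3 e 3).
have ybig : 3000 < y by move: big e27; rewrite eu; set p := 3 ^ e; clearbody p => *; nia.
case: oy => [x v v0 vx ey fy|s t hs ht ey rst].
  have x0 := leq_trans v0 vx; rewrite ry ey in ru.
  have hb : 4 * (x * v) <= 9 * (x + v).
    by apply: (rho_sum_bound x0 v0 (isT : 0 < 4) fy); lra.
  have /orP[/eqP v1|/eqP v2] : (v == 1) || (v == 2) by nia.
    rewrite v1 in ey fy ru; have h : 2000 * (x + 1) <= 2001 * x by lia.
    have := rho_summand x0 (isT : 0 < 2000) fy h ru; rewrite f_1 expr1 => rx.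
    have : (367 / 100 < rho x)%R; last by lra.
    case: (posnP k) => [k0|k0].
      by apply: (@pow2_defect i e) => //; rewrite -ey -eq' k0 muln1.
    apply: (@smooth_sub2_defect i k) => //.
    by rewrite eq' (ek k0) mul1n ey -addnA.
  rewrite v2 in ey fy ru; have h : 1000 * (x + 2) <= 1002 * x by lia.
  have := rho_summand x0 (isT : 0 < 1000) fy h ru; rewrite f_2 => rx.
  have [||d [c [ex _ d2]]] := @low_rho_pow98 x 2 x0 => //; first by lra.
  case: (posnP k) => [k0|k0]; exfalso.
    apply: (@no_add2_cofactor i e d c) => //.
    by rewrite -ex -ey -eq' k0 muln1.
  apply: (@smooth_add3 i k d c) => //.
  by rewrite eq' (ek k0) mul1n ey -ex -addnA.
have /andP[os ot] : odd s && odd t.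
  by rewrite -oddM -ey; move: ou; rewrite eu oddM => /andP[].
have [rs rt] := (rho_odd os hs, rho_odd ot ht); rewrite ry rst in ru *.
split; last by nra.
rewrite ltnNge; apply/negP => i30.
wlog rs' : s t hs ht ey rst os ot rs rt ru / (rho s <= 663 / 200)%R => [wl|].
  have [h|h] := leP (rho s) (663 / 200)%R; first exact: (wl s t).
  apply: (wl t s) => //; rewrite 1?mulnC // 1?mulrC //.
  by nra.
have [c [q [es hq]]] := odd_rho_le_3315 os hs rs'.
(* The other factor has [rho] at most [(2197 / 200) / (243 / 125)], which is below [283 / 50]. *)
have [|d [z [et hz]]] := odd_rho_le_566 ot ht; first by nra.
have eq2 : 2 ^ i * 3 ^ k = 3 ^ (e + c + d) * (q * z) + 1.
  by rewrite eq' ey es et !expnD; ring.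
have [e4' ek'] := smooth_pred_pow3 hi eq2.
have e27' : 3 ^ (e + c + d) <= 2 ^ 5.
  by apply: (@leq_trans (3 ^ 3)) => //; rewrite leq_exp2l.
(* For small [z] the product is at most [2 ^ 5 * 2 ^ 8 * 2 ^ 16 = 2 ^ 29]; hence the threshold 30
   for [i]. *)
case: hz => [z163|[a [b [a5 ez]]]].
  have /allP small : all (leq^~ 163) [:: 5; 7; 13; 19; 55; 163] by [].
  have q8 : q <= 2 ^ 8 by apply: leq_trans (small q hq) _.
  have z16 : z <= 2 ^ 8 * 2 ^ 8.
    by apply: leq_trans z163 _; apply: leq_mul.
  have h1 : 3 ^ (e + c + d) * (q * z) <= 2 ^ 29.
    rewrite (_ : 29 = 5 + (8 + (8 + 8))) // (expnD 2 5) (expnD 2 8 (8 + 8)) (expnD 2 8 8).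
    by apply: leq_mul => //; apply: leq_mul.
  have h2 : 2 ^ 30 <= 2 ^ i * 3 ^ k.
    by apply: (@leq_trans (2 ^ i)); rewrite ?leq_exp2l // leq_pmulr // expn_gt0.
  move: h2 h1; rewrite eq2 (expnS 2 29).
  have : 2 ^ 1 <= 2 ^ 29 by rewrite leq_exp2l.
  set P := 2 ^ 29; set Q := _ * (q * z); clearbody P Q; rewrite expn1.
  by clear; lia.
case: (posnP k) => [k0|k0].
  apply: (@no_mul_cofactor i (e + c + d) q a b) => //.
  by rewrite -ez -mulnA -eq2 k0 muln1.
apply: (@smooth_pred_mul i k q a b) => //.
by rewrite eq2 (ek' k0) mul1n ez.
Qed.

(** * Exact complexity of [2 ^ i * 3 ^ k] for [i < 40] *)

Lemma dvdn_smooth i k d : d %| 2 ^ i * 3 ^ k -> smooth d.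
Proof.
elim: i d => [|i IH] d.
  rewrite mul1n => /dvdn_pfactor[] // m _ ->.
  by apply/smoothP; exists 0, m; rewrite mul1n.
have [d2|d2] := boolP (2 %| d).
  rewrite -{1}(divnK d2) [_ * 2]mulnC expnS -mulnA dvdn_pmul2l // => /IH h.
  rewrite -(divnK d2) smooth_mul //; by apply/smoothP; exists 1, 0.
rewrite expnS -mulnA Gauss_dvdr; first exact: IH.
by rewrite coprime_sym prime_coprime.
Qed.

Lemma smooth_inj a b c d : 2 ^ a * 3 ^ b = 2 ^ c * 3 ^ d -> a = c /\ b = d.
Proof.
move=> e; have e2 := congr1 (logn 2) e; have e3 := congr1 (logn 3) e.
move: e2 e3; rewrite !lognM ?expn_gt0 // !lognX !logn_prime //=.
by rewrite !muln0 !muln1 !addn0.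
Qed.

(** The full cost corresponds to [(9 / 8) ^ i], and each 1 saved divides [rho] by 3. *)
Lemma rho_smooth_lt n i k : n = 2 ^ i * 3 ^ k -> f n < 2 * i + 3 * k ->
  (rho n * 3%:R <= (9 / 8) ^+ i)%R.
Proof.
move=> en fn; have n0 : 0 < n by rewrite en muln_gt0 !expn_gt0.
have n30 : (0 < n%:R ^+ 3 :> Qf)%R by rewrite exprn_gt0 // ltr0n.
rewrite /rho mulrAC -exprSr.
rewrite -(smooth_ratio i k) -en.
rewrite ler_pM2r ?invr_gt0 // ler_eXn2l //; lra.
Qed.

Theorem f_smooth_ge i k : i < 40 -> 2 * i + 3 * k <= f (2 ^ i * 3 ^ k).
Proof.
move: {2}(2 ^ i * 3 ^ k) (leqnn (2 ^ i * 3 ^ k)) => m.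
elim: m i k => [|m IH] i k hm i40.
  by move: hm; rewrite leqNgt muln_gt0 !expn_gt0.
set n := 2 ^ i * 3 ^ k in hm *; have en : n = 2 ^ i * 3 ^ k by [].
have n0 : 0 < n by rewrite en muln_gt0 !expn_gt0.
clearbody n; have [n1|n1] := leqP n 1.
  have : 2 ^ i * 3 ^ k = 2 ^ 0 * 3 ^ 0 by rewrite -en; lia.
  by move=> /smooth_inj[-> ->].
case: (f_top n1) => [x v v0 vx exv fn|x y x1 y1 exy fn]; last first.
  have /smoothP[a [b ex]] : smooth x by apply: (@dvdn_smooth i k); rewrite -en exy dvdn_mulr.
  have /smoothP[c [d ey]] : smooth y by apply: (@dvdn_smooth i k); rewrite -en exy dvdn_mull.
  have : 2 ^ i * 3 ^ k = 2 ^ (a + c) * 3 ^ (b + d) by rewrite -en exy ex ey !expnD mulnACA.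
  move=> /smooth_inj[ei ek].
  have ha : 2 * a + 3 * b <= f x by rewrite ex IH -?ex; [|nia|lia].
  have hc : 2 * c + 3 * d <= f y by rewrite ey IH -?ey; [|nia|lia].
  by rewrite fn ei ek; lia.
rewrite leqNgt; apply/negP => flt.
have rn := rho_smooth_lt en flt; have rn1 := rho_ge1 n0.
have x0 := leq_trans v0 vx.
have h98 : (1 < 9 / 8 :> Qf)%R by lra.
have le98 a b : a <= b -> ((9 / 8) ^+ a <= (9 / 8) ^+ b :> Qf)%R.
  by move=> ab; rewrite ler_eXn2l.
have pow_le_n j : j <= i -> 2 ^ j <= n.
  move=> ji; rewrite en (@leq_trans (2 ^ i)) ?leq_exp2l //.
  by rewrite leq_pmulr // expn_gt0.
(* [(9 / 8) ^ 9 < 3], so [i <= 9] would give [rho n < 1]. *)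
have i10 : 9 < i.
  rewrite ltnNge; apply/negP => /le98 h.
  have : ((9 / 8) ^+ 9 < 3%:R :> Qf)%R by lra.
  by lra.
have n1024 : 1024 <= n by apply: (pow_le_n 10).
have r39 : (rho n * 3%:R <= (9 / 8) ^+ 39)%R by apply: le_trans rn (le98 _ _ _).
rewrite exv in fn.
(* [321 / 100] exceeds the cube root of [(9 / 8) ^ 39 / 3]. *)
have hb : 100 * (x * v) <= 321 * (x + v).
  apply: (rho_sum_bound x0 v0 (isT : 0 < 100) fn); rewrite -exv.
  by lra.
have v6 : v <= 6 by nia.
have v3 : v <= 3.
  rewrite exv in n1024.
  by case: v v6 {v0 vx exv fn} hb n1024 => [|[|[|[|[|[|[|]]]]]]] //= *; lia.
have fv : f v = v by case: v v0 v3 {vx exv fn hb v6} => [|[|[|[|]]]] // _ _; rewrite ?f_1 ?f_2 ?f_3.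
have rxle : (rho (x + v) <= (9 / 8) ^+ i / 3%:R)%R by rewrite -exv; lra.
have rx1 := rho_ge1 x0.
(* Up to 18 even the summand 1 would leave [rho x < 1]. *)
have i19 : 18 < i.
  rewrite ltnNge; apply/negP => /le98 h.
  have h1 : 300 * (x + v) <= 303 * x by lia.
  have := rho_summand x0 (isT : 0 < 300) fn h1 rxle; rewrite fv => h2.
  have h3 : (3%:R <= 3%:R ^+ v :> Qf)%R by rewrite -{1}(expr1 3%:R%R) ler_eXn2l //; lra.
  have : ((9 / 8) ^+ 18 < 87 / 10 :> Qf)%R by lra.
  by nra.
have hi : 19 <= i < 40 by rewrite i19.
have nbig : 300 * 300 < n.
  by apply: leq_trans (pow2_gt i19) (pow_le_n _ (leqnn _)).
have h1 : (120 * 120) * (x + v) <= (120 * 120 + v) * x by nia.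
have := rho_summand x0 (isT : 0 < 120 * 120) fn h1 rxle; rewrite fv natrD natrM => rx.
have i39 := le98 _ _ (i40 : i <= 39).
(* For [v] equal to 1, 2 and 3 the bounds on [rho x] are below [2197 / 200], [367 / 100] and
   [(9 / 8) ^ 2]. In the first case [i < 30] follows, and [(9 / 8) ^ 29 / 9 < 377 / 100] gives the
   contradiction. *)
case: v v0 v3 {v6 vx hb rxle h1 fv fn} exv rx => [|[|[|[|]]]] // _ _ exv rx.
- have [||i30 rx'] := @smooth_pred_defect i k x hi _ _; first by rewrite -en exv.
    by lra.
  by have := le98 i 29 i30; lra.
- have := @smooth_sub2_defect i k x hi; rewrite -en => /(_ exv).
  by lra.
have [||d [c [ex _ d2]]] := @low_rho_pow98 x 2 x0 => //; first by lra.
by apply: (@smooth_add3 i k d c) => //; rewrite -en -ex.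
Qed.

(** * Numbers of bounded defect are sparse in base 3 *)

Definition sum3 (s : seq nat) : nat := \sum_(a <- s) 3 ^ a.

(** Exponents may repeat, so sums and products of such numbers need no carries. *)
Definition sparse (D n : nat) : Prop := exists s, n = sum3 s /\ size s <= D.

Lemma sparse_le D D' n : D <= D' -> sparse D n -> sparse D' n.
Proof. by move=> h [s [es hs]]; exists s; rewrite (leq_trans hs). Qed.

Lemma sum3_nseq0 n : sum3 (nseq n 0) = n.
Proof. by rewrite /sum3 big_nseq iter_addn addn0 mul1n. Qed.

Lemma sparse_small n : sparse n n.
Proof. by exists (nseq n 0); rewrite sum3_nseq0 size_nseq. Qed.

Lemma sparse_add D D' m n : sparse D m -> sparse D' n -> sparse (D + D') (m + n).
Proof.
move=> [s [-> hs]] [t [-> ht]]; exists (s ++ t).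
by rewrite /sum3 big_cat size_cat leq_add.
Qed.

Lemma sum3_mul s t : sum3 s * sum3 t = sum3 [seq a + b | a <- s, b <- t].
Proof.
rewrite /sum3 big_allpairs_dep big_distrlr; apply: eq_bigr => a _.
by apply: eq_bigr => b _; rewrite expnD.
Qed.

Lemma sparse_mul D D' m n : sparse D m -> sparse D' n -> sparse (D * D') (m * n).
Proof.
move=> [s [-> hs]] [t [-> ht]]; exists [seq a + b | a <- s, b <- t].
by rewrite sum3_mul size_allpairs leq_mul.
Qed.

Lemma sparse_pow3 e : sparse 1 (3 ^ e).
Proof. by exists [:: e]; rewrite /sum3 big_seq1. Qed.

(** Induction on [K] after stripping powers of 3: in a product each factor takes at least [9 / 8]
    from the other, and a sum has a bounded summand and, unless it is small, a large one of lower
    [rho]. *)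
Lemma rho_sparse K : exists D, forall n, 0 < n -> (rho n <= (9 / 8) ^+ K)%R ->
  sparse D n.
Proof.
elim: K => [|K [D IH]].
  exists 1 => n n0; rewrite expr0 => rn.
  have [/pow3P[c ->]|hn] := boolP (pow3 n); first exact: sparse_pow3.
  by have := rho_nonpow3 n0 hn; lra.
pose p := 2 ^ K.+1; pose V := 2 * p.
(* The terms stand for a power of 3, a product, a sum with large [x], and a core below [11 * V]. *)
exists (1 + D * D + (D + V) + 11 * V) => n n0 rn.
have [/pow3P[c ->]|hn] := boolP (pow3 n).
  by apply: sparse_le (sparse_pow3 c); lia.
have [e [y [en ry hy oy]]] := strip_pow3 n0 hn.
have y0 : 0 < y by move: n0; rewrite en muln_gt0 => /andP[].
suff [D' [hD' sy]] : exists D', D' <= D * D + (D + V) + 11 * V /\ sparse D' y.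
  apply: sparse_le (_ : 1 * D' <= _) _; first by lia.
  by rewrite en; apply: sparse_mul sy; exact: sparse_pow3.
rewrite ry exprS in rn.
have pK0 : (0 < (9 / 8) ^+ K :> Qf)%R by rewrite exprn_gt0 //; lra.
case: oy => [x v v0 vx ey fy|s t hs ht ey rst]; last first.
  have /andP[s0 t0] : (0 < s) && (0 < t) by rewrite -muln_gt0 -ey.
  have [rs rt] := (rho_nonpow3 s0 hs, rho_nonpow3 t0 ht).
  rewrite rst in rn; exists (D * D); split; first by lia.
  rewrite ey; apply: sparse_mul; apply: IH => //; nra.
have x0 := leq_trans v0 vx.
have hb : 1 * (x * v) <= p * (x + v).
  apply: (rho_sum_bound x0 v0 (isT : 0 < 1) fy).
  rewrite -ey; apply: (le_trans rn); rewrite divr1 -exprS.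
  rewrite /p natrX -exprM.
  have h98 : (9 / 8 <= 2%:R :> Qf)%R by lra.
  apply: (@le_trans _ _ (2%:R ^+ K.+1)%R).
    by rewrite lerXn2r ?nnegrE //; lra.
  rewrite ler_eXn2l ?leq_pmulr //; lra.
have vV : v <= V by rewrite /V; nia.
have [xV|xV] := leqP (10 * V) x; last first.
  exists y; split; last exact: sparse_small.
  by rewrite ey; lia.
exists (D + V); split; first by lia.
rewrite ey; apply: sparse_add; last exact: sparse_le vV (sparse_small v).
apply: IH => //.
have h1 : 10 * (x + v) <= 11 * x by lia.
rewrite ey in rn; have := rho_summand x0 (isT : 0 < 10) fy h1 rn.
have h3 : (3%:R <= 3%:R ^+ f v :> Qf)%R.
  rewrite -{1}(expr1 3%:R%R) ler_eXn2l ?f_gt0 //; lra.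
by have := rho_ge1 x0; nra.
Qed.

(** * Carries in sums of powers of 3, and sparse factors of [A * 3 ^ m + B] *)

Lemma sum_lt_succ s t : \sum_(x <- s | x < t.+1) 3 ^ x =
  \sum_(x <- s | x < t) 3 ^ x + count_mem t s * 3 ^ t.
Proof.
elim: s => [|x s IH]; first by rewrite !big_nil.
rewrite !big_cons /= ltnS; case: ltngtP => h /=; rewrite IH ?h.
- by rewrite addnA.
- by [].
by rewrite mulnDl mul1n addnCA.
Qed.

Lemma count_lt_succ (s : seq nat) t :
  count (fun x => x < t.+1) s = count (fun x => x < t) s + count_mem t s.
Proof.
elim: s => [|x s IH] //=; rewrite IH ltnS addnACA; congr (_ + _).
by case: ltngtP.
Qed.

Lemma sum_lt_le_count (s : seq nat) t :
  \sum_(x <- s | x < t) 3 ^ x <= count (fun x => x < t) s * 3 ^ t.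
Proof.
elim: s => [|x s IH]; first by rewrite big_nil.
rewrite big_cons /=; case: ltnP => // xt; rewrite mulnDl mul1n leq_add //.
by rewrite leq_exp2l // ltnW.
Qed.

Lemma sum3_mod s t : sum3 s = \sum_(x <- s | x < t) 3 ^ x %[mod 3 ^ t].
Proof.
rewrite /sum3 (bigID (fun x => x < t)) /=; apply/eqP.
rewrite -[X in _ == X %[mod _]]addn0 eqn_modDl mod0n.
apply/dvdn_sum => x; rewrite -leqNgt; exact: dvdn_exp2l.
Qed.

Lemma mem_le_sum (s : seq nat) (P : pred nat) a : a \in s -> P a ->
  3 ^ a <= \sum_(x <- s | P x) 3 ^ x.
Proof. by move=> sa Pa; rewrite (big_rem a) //= Pa leq_addr. Qed.

(* A carry that starts at position [a] must be fed at every position up to [m], and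
   each feeding uses up terms of the sum. *)
Lemma sum3_gap s A m B a : sum3 s = A * 3 ^ m + B -> a \in s -> B < 3 ^ a ->
  m <= a + size s.
Proof.
move=> es sa Ba; have [/leq_trans->|am] // := leqP m a; first by rewrite leq_addr.
have carry t : a < t <= m -> 3 ^ t <= \sum_(x <- s | x < t) 3 ^ x.
  case/andP=> ta tm; rewrite leqNgt; apply/negP => St.
  have Bt : B < 3 ^ t by apply: leq_trans Ba _; rewrite leq_exp2l // ltnW.
  have := sum3_mod s t; rewrite es -(subnK tm) expnD mulnA modnMDl !modn_small //.
  by move=> eB; have := mem_le_sum (P := fun x => x < t) sa ta; rewrite -eB; lia.
(* Scaling the invariant by 3 frees twice the sum below the next position, at least
   [2 * 3 ^ (a + d + 1)] by [carry]; so every position uses up two terms. *)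
have inv d : a + d <= m -> 2 * d * 3 ^ (a + d) + \sum_(x <- s | x < a + d) 3 ^ x <=
    count (fun x => x < a + d) s * 3 ^ (a + d).
  elim: d => [|d IH] hd; first by rewrite addn0 sum_lt_le_count.
  have {}IH := IH (leq_trans (leq_add (leqnn _) (leqnSn d)) hd).
  rewrite addnS in hd *.
  have := carry (a + d).+1; rewrite hd andbT ltnS leq_addr => /(_ isT).
  rewrite sum_lt_succ count_lt_succ expnS; move: IH.
  set S := \sum_(_ <- _ | _) _; set n := count _ s; set c := count _ s; set p := 3 ^ _.
  by clearbody S n c p; nia.
have := inv (m - a); rewrite subnKC ?(ltnW am) // => /(_ (leqnn _)) h.
have : 2 * (m - a) * 3 ^ m <= size s * 3 ^ m.
  apply: leq_trans (leq_trans (leq_addr _ _) h) _.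
  by rewrite leq_mul2r count_size orbT.
by rewrite leq_pmul2r ?expn_gt0 //; lia.
Qed.

Lemma sum3_split s g B : (forall b, b \in s -> 3 ^ b <= B \/ g <= b) ->
  exists A' B', sum3 s = A' * 3 ^ g + B' /\ B' <= size s * B.
Proof.
elim: s => [|x s IH] h; first by exists 0, 0; rewrite /sum3 big_nil.
have [|A' [B' [e hB]]] := IH; first by move=> b sb; apply: h; rewrite inE sb orbT.
rewrite /sum3 big_cons -/(sum3 s) e /= mulSn.
have [hx|hx] := h x (mem_head _ _).
  by exists A', (3 ^ x + B'); rewrite addnCA leq_add.
exists (3 ^ (x - g) + A'), B'; rewrite mulnDl -expnD subnK // addnA; split=> //.
exact: leq_trans hB (leq_addl _ _).
Qed.

Lemma sum3_le s B : (forall a, a \in s -> 3 ^ a <= B) -> sum3 s <= size s * B.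
Proof.
elim: s => [|x s IH] h; first by rewrite /sum3 big_nil.
rewrite /sum3 big_cons /= mulSn leq_add ?h ?mem_head // IH // => a sa.
by apply: h; rewrite inE sa orbT.
Qed.

Lemma mem_le_sum3 s a : a \in s -> 3 ^ a <= sum3 s.
Proof. by move=> sa; apply: (mem_le_sum (P := xpredT)). Qed.

(** The products of terms of [U] and [W] add up to [A * 3 ^ m + B], so by [sum3_gap] each is at most
    [B] or has exponent at least [m - D * D]. If both factors had a term above [B], some product
    would have exponent near [2 * m]; so one factor has low terms only. *)
Lemma sparse_factor D A B : 0 < B -> exists M G C, forall m U W, M <= m ->
  sparse D U -> sparse D W -> U * W = A * 3 ^ m + B ->
  exists u w A' B', [/\ (u = U /\ w = W) \/ (u = W /\ w = U), u <= C,
    w = A' * 3 ^ (m - G) + B', u * B' = B & u * A' = A * 3 ^ G].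
Proof.
(* [d] bounds the number of products of terms. A low term has exponent below [B], so the high terms
   of the other factor start at [m - B - d]; hence [G]. *)
move=> B0; pose d := D * D; pose G := B + d; pose C := D * B.
exists (G + C * C + A + 2 * B + 2 * d).+1, G, C => m U W hm [s [eU hs]] [t [eW ht]] eN.
have gap s' t' : size s' <= D -> size t' <= D -> sum3 s' * sum3 t' = A * 3 ^ m + B ->
    forall a b, a \in s' -> b \in t' -> B < 3 ^ (a + b) -> m <= a + b + d.
  move=> hs' ht' e a b sa tb Bab; rewrite sum3_mul in e.
  have /(sum3_gap e)/(_ Bab) h : a + b \in [seq x + y | x <- s', y <- t'].
    by apply: allpairs_f.
  by apply: leq_trans h _; rewrite size_allpairs leq_add2l leq_mul.
have small s' t' : size s' <= D -> size t' <= D -> sum3 s' * sum3 t' = A * 3 ^ m + B ->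
    (forall a, a \in s' -> 3 ^ a <= B) ->
    exists A' B', [/\ sum3 s' <= C, sum3 t' = A' * 3 ^ (m - G) + B',
      sum3 s' * B' = B & sum3 s' * A' = A * 3 ^ G].
  move=> hs' ht' e low.
  have U0 : 0 < sum3 s'.
    by rewrite lt0n; apply/eqP => u0; move: e; rewrite u0 mul0n; lia.
  have [a2 sa2] : exists a, a \in s'.
    case: s' U0 {hs' e low} => [|a s'']; first by rewrite /sum3 big_nil.
    by exists a; rewrite mem_head.
  have UC : sum3 s' <= C by apply: leq_trans (sum3_le low) _; rewrite leq_mul.
  have [|A' [B' [eW' hB']]] := @sum3_split t' (m - G) B.
    move=> b tb; have [h|h] := leqP (3 ^ b) B; [by left|right].
    have := gap s' t' hs' ht' e a2 b sa2 tb.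
    have a2B : a2 < B by apply: leq_trans (low _ sa2); exact: ltn_expl.
    have Bab : B < 3 ^ (a2 + b).
      by apply: leq_trans h _; rewrite leq_exp2l // leq_addl.
    by move=> /(_ Bab); rewrite /G; lia.
  exists A', B'.
  have B'C : B' <= C by apply: leq_trans hB' _; rewrite leq_mul.
  have pm : C * C + B < 3 ^ (m - G).
    by apply: leq_trans (ltn_expl (m - G) (isT : 1 < 3)); rewrite /G in hm *; lia.
  have e' : sum3 s' * A' * 3 ^ (m - G) + sum3 s' * B' = A * 3 ^ G * 3 ^ (m - G) + B.
    rewrite -mulnA -mulnDr -eW' e -[A * 3 ^ G * _]mulnA -expnD subnKC //.
    by rewrite /G in hm *; lia.
  (* Both remainders are below [3 ^ (m - G)], so quotients and remainders agree. *)
  have := congr1 (edivn^~ (3 ^ (m - G))) e'.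
  have UB : sum3 s' * B' <= C * C by apply: leq_mul.
  rewrite !edivn_eq; [|by lia|by lia].
  by move=> [h1 h2]; split.
have [/hasP[a1 sa1 Ba1]|nos] := boolP (has (fun a => B < 3 ^ a) s); last first.
  have [||A' [B' [h1 h2 h3 h4]]] := small s t hs ht; first by rewrite -eU -eW.
    by move=> a sa; rewrite leqNgt; apply: contra nos => h; apply/hasP; exists a.
  by exists U, W, A', B'; rewrite eU eW; split=> //; left.
have [/hasP[b1 tb1 Bb1]|not] := boolP (has (fun a => B < 3 ^ a) t); last first.
  have [||A' [B' [h1 h2 h3 h4]]] := small t s ht hs; first by rewrite -eU -eW mulnC.
    by move=> a sa; rewrite leqNgt; apply: contra not => h; apply/hasP; exists a.
  by exists W, U, A', B'; rewrite eU eW; split=> //; right.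
exfalso; rewrite eU eW in eN.
have gapst := gap s t hs ht eN.
(* Without such a pair, [3 ^ (m - d)] would divide [B]. *)
have [a0 [b0 [sa0 tb0 B00]]] : exists a b, [/\ a \in s, b \in t & 3 ^ (a + b) <= B].
  have [/hasP[a sa /hasP[b tb h]]|no] :=
      boolP (has (fun a => has (fun b => 3 ^ (a + b) <= B) t) s).
    by exists a, b.
  have [x|A' [B' [e hB']]] := @sum3_split [seq x + y | x <- s, y <- t] (m - d) 0.
    move=> /allpairsP[[a b] /= [sa tb ->]]; right.
    have Bab : B < 3 ^ (a + b).
      rewrite ltnNge; apply: contra no => h.
      by apply/hasP; exists a => //; apply/hasP; exists b.
    by have := gapst a b sa tb Bab; lia.
  have B'0 : B' = 0 by lia.
  rewrite -sum3_mul eN B'0 addn0 in e.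
  have /dvdn_leq : 3 ^ (m - d) %| B.
    have dA : 3 ^ (m - d) %| A * 3 ^ m by rewrite dvdn_mull // dvdn_exp2l // leq_subr.
    by rewrite -(dvdn_addr _ dA) e dvdn_mull.
  move=> /(_ B0) h; have := leq_trans (ltn_expl (m - d) (isT : 1 < 3)) h.
  by rewrite /G in hm; lia.
(* [a1 + b0] and [a0 + b1] are at least [m - d] while [a0 + b0 < B], so [a1 + b1] is near [2 * m],
   against its bound [A + B + m]. *)
have h1 : m <= a1 + b0 + d.
  by apply: gapst => //; apply: leq_trans Ba1 _; rewrite leq_exp2l // leq_addr.
have h2 : m <= a0 + b1 + d.
  by apply: gapst => //; apply: leq_trans Bb1 _; rewrite leq_exp2l // leq_addl.
have h0 : a0 + b0 < B by apply: leq_trans B00; exact: ltn_expl.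
have h3 : a1 + b1 < A + B + m.
  rewrite -(@ltn_exp2l 3) // expnD.
  apply: leq_ltn_trans (leq_mul (mem_le_sum3 sa1) (mem_le_sum3 tb1)) _.
  rewrite eN; apply: leq_ltn_trans (_ : (A + B) * 3 ^ m < _).
    by rewrite mulnDl leq_add2l leq_pmulr // expn_gt0.
  by rewrite expnD ltn_pmul2r ?expn_gt0 // ltn_expl.
by rewrite /G in hm; lia.
Qed.

(** * Lower bound for [f (A * 3 ^ m + B)] at large [m] *)

Lemma eventually_forall_le (P : nat -> nat -> Prop) C :
  (forall u, exists M, forall m, M <= m -> P u m) ->
  exists M, forall m, M <= m -> forall u, u <= C -> P u m.
Proof.
move=> h; elim: C => [|C [M IH]].
  by have [M hM] := h 0; exists M => m mM u; rewrite leqn0 => /eqP->; exact: hM.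
have [M' hM'] := h C.+1; exists (M + M') => m mM u.
rewrite leq_eqVlt ltnS => /orP[/eqP->|uC]; first by apply: hM'; lia.
by apply: IH => //; lia.
Qed.

Lemma rho_add_pow3_le A B m : 0 < A -> f (A * 3 ^ m + B) <= f A + 3 * m ->
  (rho (A * 3 ^ m + B) <= 3%:R ^+ f A)%R.
Proof.
move=> A0 h; set n := A * 3 ^ m + B in h *.
have nm : 3 ^ m <= n by apply: leq_trans (leq_pmull _ A0) (leq_addr _ _).
have n0 : 0 < n by apply: leq_trans nm; rewrite expn_gt0.
rewrite /rho ler_pdivrMr ?exprn_gt0 ?ltr0n // -!natrX -natrM ler_nat.
apply: (@leq_trans (3 ^ (f A + 3 * m))); first by rewrite leq_exp2l.
by rewrite expnD leq_mul2l mulnC expnM leq_exp2r // nm orbT.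
Qed.

(** [K] and [L] express a lower bound [K - L] for [f (A * 3 ^ k) - 3 * k] without truncated
    subtraction. They vary in the induction: passing to the cofactor of [u] turns [A] into
    [A * 3 ^ G / u], [K] into [K + 3 * G] and [L] into [L + f u]. *)
Theorem f_add_pow3_ge B : 0 < B -> forall A K L, 0 < A ->
  (forall k, K + 3 * k <= L + f (A * 3 ^ k)) ->
  exists M, forall m, M <= m -> K + 3 * m + 1 <= L + f (A * 3 ^ m + B).
Proof.
elim/ltn_ind: B => B IH B0 A K L A0 hK.
pose p := 3 ^ f A; pose V := 2 * p.
(* [(9 / 8) ^ 10 >= 3], and the extra [3 ^ 2] absorbs the factor [2 ^ 3] lost in passing from
   [x + v] to [x]. *)
have [D hD] := rho_sparse (10 * (f A).+2).
have hp : (3%:R ^+ f A * 8 <= (9 / 8) ^+ (10 * (f A).+2) :> Qf)%R.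
  rewrite exprM; apply: (@le_trans _ _ (3%:R ^+ (f A).+2)%R).
    by rewrite !exprSr -mulrA ler_wpM2l ?exprn_ge0 ?ler0n //; lra.
  rewrite lerXn2r ?nnegrE ?ler0n ?exprn_ge0 //; lra.
have [M1 [G [C hF]]] := sparse_factor D A B0.
have [u|M2 hM2] := @eventually_forall_le (fun u m => forall A' B', 1 < u ->
    u * B' = B -> u * A' = A * 3 ^ G ->
    K + 3 * G + 3 * m + 1 <= L + f u + f (A' * 3 ^ m + B')) C.
  have [u1|u1] := leqP u 1; first by exists 0.
  have [uB|uB] := boolP (u %| B); last first.
    by exists 0 => m _ A' B' _ e; move: uB; rewrite -e dvdn_mulr.
  have [uA|uA] := boolP (u %| A * 3 ^ G); last first.
    by exists 0 => m _ A' B' _ _ e; move: uA; rewrite -e dvdn_mulr.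
  have u0 := ltnW u1.
  have [||||M hM] := IH (B %/ u) _ _ (A * 3 ^ G %/ u) (K + 3 * G) (L + f u).
  - by rewrite ltn_Pdiv.
  - by rewrite divn_gt0 // dvdn_leq.
  - by rewrite divn_gt0 // dvdn_leq // muln_gt0 A0 expn_gt0.
  - move=> k; have := hK (G + k); have := @f_mul u (A * 3 ^ G %/ u * 3 ^ k) u0.
    rewrite mulnA [u * _]mulnC divnK // muln_gt0 expn_gt0 divn_gt0 // dvdn_leq //; last first.
      by rewrite muln_gt0 A0 expn_gt0.
    by rewrite expnD mulnA => /(_ isT); lia.
  exists M => m /hM h A' B' _ eB eA.
  by move: h; rewrite -eB -eA !mulKn.
have [v|M3 hM3] := @eventually_forall_le (fun v m => 0 < v < B ->
    K + 3 * m + 1 <= L + f (A * 3 ^ m + (B - v))) B.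
  have [/andP[v0 vB]|nv] := boolP (0 < v < B); last by exists 0.
  have [||M hM] := IH (B - v) _ _ A K L A0 hK; [by lia|by lia|].
  by exists M => m /hM.
exists (M1 + G + M2 + M3 + D + V).+1 => m hm.
set n := A * 3 ^ m + B; rewrite leqNgt; apply/negP => hn.
have n1 : 1 < n by rewrite /n -addn1 leq_add // muln_gt0 A0 expn_gt0.
have hK0 := hK 0; rewrite muln1 muln0 addn0 in hK0.
have rn : (rho n <= 3%:R ^+ f A)%R by apply: rho_add_pow3_le => //; rewrite -/n; lia.
have rn1 := rho_ge1 (ltnW n1).
case: (f_top n1) => [x v v0 vx en fn|x y x1 y1 en fn]; last first.
  have rxy : rho n = (rho x * rho y)%R by rewrite en rho_mul -?en.
  have [rx ry] := (rho_ge1 (ltnW x1), rho_ge1 (ltnW y1)).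
  have [sx sy] : sparse D x /\ sparse D y.
    by split; apply: hD; rewrite ?(ltnW x1) ?(ltnW y1) //; nra.
  have [||u [w [A' [B' [euw uC ew eB eA]]]]] := hF m x y _ sx sy; first by lia.
    by rewrite -en.
  have u1 : 1 < u by case: euw => [[-> _]|[-> _]].
  have fuw : f n = f u + f w by case: euw => [[-> ->]|[-> ->]]; rewrite fn // addnC.
  have mG : M2 <= m - G by lia.
  by have := hM2 _ mG u uC A' B' u1 eB eA; rewrite -ew; lia.
rewrite en in fn rn; have x0 := leq_trans v0 vx.
have vV : v <= V.
  have hb : 1 * (x * v) <= p * (x + v).
    apply: (rho_sum_bound x0 v0 (isT : 0 < 1) fn); apply: (le_trans rn).
    rewrite divr1 /p natrX -exprM ler_eXn2l ?leq_pmulr //; lra.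
  by rewrite /V; nia.
have fv := f_gt0 v0.
have sx : sparse D x.
  apply: hD => //; have h2 : 1 * (x + v) <= 2 * x by lia.
  have := rho_summand x0 (isT : 0 < 1) fn h2 rn.
  have h3 : (1 <= 3%:R ^+ f v :> Qf)%R by rewrite exprn_ege1 // ler1n.
  by have := rho_ge1 x0; rewrite divr1; nra.
case: (ltngtP v B) => vB.
- have ex : x = A * 3 ^ m + (B - v) by rewrite /n in en; lia.
  have mM : M3 <= m by lia.
  have := hM3 _ mM v (ltnW vB); rewrite v0 vB -ex => /(_ isT).
  by rewrite en fn in hn; lia.
(* Here [x] falls short of [A * 3 ^ m] by [v - B]. Adding that many ones represents [A * 3 ^ m] with
   few terms, one of exponent 0, which [sum3_gap] forbids for large [m]. *)
- have [s' [es2 ss']] := sx.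
  have e3 : sum3 (nseq (v - B) 0 ++ s') = A * 3 ^ m + 0.
    by rewrite /sum3 big_cat /= -!/(sum3 _) sum3_nseq0 -es2 addn0; rewrite /n in en; lia.
  have m0 : 0 \in nseq (v - B) 0 ++ s' by rewrite mem_cat mem_nseq subn_gt0 vB.
  by have := sum3_gap e3 m0 isT; rewrite size_cat size_nseq; lia.
have ex : x = A * 3 ^ m by rewrite /n in en; lia.
by have := hK m; rewrite -ex; rewrite en fn in hn; lia.
Qed.

(** * The value of [D] *)

Lemma exp_10_12_le : 10 ^ 12 <= 2 ^ 40.
(* This is [1000 ^ 4 <= 1024 ^ 4]. *)
Proof. by rewrite -[12]/(3 * 4) -[40]/(10 * 4) !expnM leq_exp2r. Qed.

Theorem theorem2p1 (i j b r : nat) :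
  b = 2 ^ i * 3 ^ j -> 0 < i + j -> b < 10 ^ 12 ->
  2 <= r -> r < b -> r %| b ->
  is_D b r ((f b)%:Z + 1)%R.
Proof.
move=> eb ij /leq_trans/(_ exp_10_12_le) b40 r2 rb rdvd.
have {b40} i40 : i < 40.
  rewrite -(ltn_exp2l i 40 (isT : 1 < 2)); apply: leq_ltn_trans b40.
  by rewrite eb leq_pmulr // expn_gt0.
have fb : f b = 2 * i + 3 * j.
  by apply/eqP; rewrite eqn_leq {1 2}eb f_smooth_le // f_smooth_ge.
have b0 : 0 < b by lia.
have r0 : 0 < r by lia.
split=> [n n0|d' hd'].
  pose c := b %/ r; have ec : b = r * c by rewrite mulnC divnK.
  have c0 : 0 < c by rewrite divn_gt0 // dvdn_leq.
  have /smoothP[s [t er]] : smooth r by apply: (@dvdn_smooth i j); rewrite -eb.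
  have /smoothP[s' [t' ec']] : smooth c.
    by apply: (@dvdn_smooth i j); rewrite -eb ec dvdn_mull.
  have [ei ej] : i = s + s' /\ j = t + t'.
    by apply: smooth_inj; rewrite -eb ec er ec' !expnD mulnACA.
  (* The bound of [f_smooth_le] fails at 1, where [f] is 1 and not 0; so both [r] and [c] have to
     exceed 1. *)
  have c1 : 1 < c by nia.
  have fr : f r <= 2 * s + 3 * t.
    rewrite er f_smooth_le // lt0n addn_eq0; apply/negP => /andP[/eqP s0 /eqP t0].
    by move: r2; rewrite er s0 t0.
  have fc : f c <= 2 * s' + 3 * t'.
    rewrite ec' f_smooth_le // lt0n addn_eq0; apply/negP => /andP[/eqP s0 /eqP t0].
    by move: c1; rewrite ec' s0 t0.
  have -> : r + b * n = r * (1 + c * n) by rewrite ec mulnDr muln1 mulnA.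
  have h1 : f (r * (1 + c * n)) <= f r + f (1 + c * n) by apply: f_mul.
  have h2 : f (1 + c * n) <= f 1 + f (c * n) by apply: f_add; rewrite ?muln_gt0 ?c0.
  have h3 : f (c * n) <= f c + f n by apply: f_mul.
  by rewrite f_1 in h2; lia.
(* By [f_smooth_ge], multiplying [b] by [3 ^ k] adds at least [3 * k] to the complexity, so these
   [K] and [L] are admissible. *)
have [|M hM] := f_add_pow3_ge r0 (A := b) (K := f b) (L := 0) b0.
  by move=> k; rewrite eb -mulnA -expnD -eb fb add0n; have := @f_smooth_ge i (j + k) i40; lia.
(* [M.+1] keeps the exponent positive, as [f (3 ^ 0)] is 1 and not 0. *)
have := hM M.+1 (leqnSn _); rewrite add0n => h.
have := hd' (3 ^ M.+1); rewrite expn_gt0 => /(_ isT).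
rewrite f_pow3 // addnC; lia.
Qed.
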